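(* Let $\mathcal R$ be a strong anti-Rota-Baxter operator of weight zero on a super-commutative Hom-associative superalgebra $(\mathcal A,\mu,\alpha)$. Then $(\mathcal A,\star_{\mathcal R},\alpha)$ is a Hom-anti-Zinbiel superalgebra, where $\star_{\mathcal R}:\mathcal A\times\mathcal A\to\mathcal A$ is defined by $x\star_{\mathcal R}y=-\mu(\mathcal R(x),y)$ for all homogeneous $x,y\in\mathcal A$.
   Context: All vector spaces are finite-dimensional over a field of characteristic $0$. Superspaces are $\mathbb Z_2$-graded, $|x|$ is the parity of a homogeneous element $x$, and identities are required for homogeneous elements. All structure maps are even (parity preserving). A super-commutative Hom-associative superalgebra is a triple $(\mathcal A,\mu,\alpha)$ with $\mu$ even bilinear and $\alpha$ even linear such that $\mu(x,y)=(-1)^{|x||y|}\mu(y,x)$ and $\mu(\mu(x,y),\alpha(z))=\mu(\alpha(x),\mu(y,z))$. An anti-Rota-Baxter operator of weight zero on $(\mathcal A,\mu,\alpha)$ is an even linear map $\mathcal R:\mathcal A\to\mathcal A$ commuting with $\alpha$ such that $\mu(\mathcal R(x),\mathcal R(y))=-\mathcal R\big(\mu(\mathcal R(x),y)+\mu(x,\mathcal R(y))\big)$. It is strong if $\mu(\mu(\mathcal R(x),\mathcal R(y)),\alpha(z))=\mu(\alpha(x),\mu(\mathcal R(y),\mathcal R(z)))$ for all $x,y,z\in\mathcal A$. A Hom-anti-Zinbiel superalgebra is a triple $(\mathcal A,\star,\alpha)$ with $\star$ even bilinear and $\alpha$ even linear such that $\alpha(x)\star(y\star z)=-(x\star y+(-1)^{|x||y|}y\star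 x)\star\alpha(z)$ and $\alpha(x)\star(y\star z)=(-1)^{|x|(|y|+|z|)}\alpha(y)\star(z\star x)$. *)

(* Defs.v *)
From mathcomp Require Import all_boot all_algebra.

Set Implicit Arguments.
Unset Strict Implicit.
Unset Printing Implicit Defensive.

Import GRing.Theory.
Local Open Scope ring_scope.

(* The group Z/2 of parities is bool: false is even, true is odd, and addition
   and multiplication of parities are (+) and &&. "x is homogeneous of parity i"
   is rendered x \in parity_part A i; the zero vector has both parities. *)
Record superspace (K : fieldType) := Superspace {
  super_carrier :> vectType K;
  parity_part : bool -> {vspace super_carrier};
  parity_part_sum : (parity_part false + parity_part true)%VS = fullv;
  parity_part_direct : directv (parity_part false + parity_part true)
}.

Section HomSuperalgebras.

Variables (K : fieldType) (A : superspace K).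

Definition is_even_linear (f : A -> A) : Prop :=
  linear f
  /\ forall (i : bool) (x : A),
       x \in parity_part A i -> f x \in parity_part A i.

Definition is_even_bilinear (m : A -> A -> A) : Prop :=
  [/\ forall y : A, linear (m ^~ y),
      forall x : A, linear (m x)
    & forall (i j : bool) (x y : A),
        x \in parity_part A i -> y \in parity_part A j ->
        m x y \in parity_part A (i (+) j)].

Record is_supercomm_Hom_assoc (mu : A -> A -> A) (alpha : A -> A) : Prop := {
  sca_mu_even_bilinear : is_even_bilinear mu;
  sca_alpha_even_linear : is_even_linear alpha;
  sca_supercomm : forall (i j : bool) (x y : A),
    x \in parity_part A i -> y \in parity_part A j ->
    mu x y = (-1) ^+ (i && j) *: mu y x;
  sca_Hom_assoc : forall (i j k : bool) (x y z : A),
    x \in parity_part A i -> y \in parity_part A j ->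
    z \in parity_part A k ->
    mu (mu x y) (alpha z) = mu (alpha x) (mu y z)
}.

Record is_anti_Rota_Baxter (mu : A -> A -> A) (alpha R : A -> A) : Prop := {
  arb_even_linear : is_even_linear R;
  arb_comm : forall x : A, R (alpha x) = alpha (R x);
  arb_identity : forall (i j : bool) (x y : A),
    x \in parity_part A i -> y \in parity_part A j ->
    mu (R x) (R y) = - R (mu (R x) y + mu x (R y))
}.

Definition is_strong_anti_Rota_Baxter
    (mu : A -> A -> A) (alpha R : A -> A) : Prop :=
  is_anti_Rota_Baxter mu alpha R
  /\ forall x y z : A,
       mu (mu (R x) (R y)) (alpha z) = mu (alpha x) (mu (R y) (R z)).

Record is_Hom_anti_Zinbiel (star : A -> A -> A) (alpha : A -> A) : Prop := {
  haz_star_even_bilinear : is_even_bilinear star;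
  haz_alpha_even_linear : is_even_linear alpha;
  haz_anti_Zinbiel : forall (i j k : bool) (x y z : A),
    x \in parity_part A i -> y \in parity_part A j ->
    z \in parity_part A k ->
    star (alpha x) (star y z)
    = - star (star x y + (-1) ^+ (i && j) *: star y x) (alpha z);
  haz_cyclic : forall (i j k : bool) (x y z : A),
    x \in parity_part A i -> y \in parity_part A j ->
    z \in parity_part A k ->
    star (alpha x) (star y z)
    = (-1) ^+ (i && (j (+) k)) *: star (alpha y) (star z x)
}.

Definition star_of (mu : A -> A -> A) (R : A -> A) : A -> A -> A :=
  fun x y => - mu (R x) y.

End HomSuperalgebras.

(* Main.v *)
Require Import Defs.
From mathcomp Require Import all_boot all_algebra.

Set Implicit Arguments.
Unset Strict Implicit.
Unset Printing Implicit Defensive.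

Import GRing.Theory.
Local Open Scope ring_scope.

(** Both identities have the same left side, which [star_of_star_of] brings to the form
    [mu (mu (R x) (R y)) (alpha z)]. The anti-Rota-Baxter identity expands the inner product
    [mu (R x) (R y)] and yields the anti-Zinbiel identity; strongness moves the bracket to the
    right, after which super-commutativity yields the cyclic one. *)

Lemma linear_opp (K : fieldType) (U V : lmodType K) (f : U -> V) :
  linear f -> {morph f : x / - x}.
Proof.
move=> f_lin x; have f0 : f 0 = 0.
  by have := f_lin (-1) x x; rewrite !scaleN1r !addNr.
by have := f_lin (-1) x 0; rewrite !scaleN1r f0 !addr0.
Qed.

Lemma star_of_even_bilinear (K : fieldType) (A : superspace K)
    (mu : A -> A -> A) (R : A -> A) :
  is_even_bilinear mu -> is_even_linear R -> is_even_bilinear (star_of mu R).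
Proof.
move=> [mu_linl mu_linr mu_even] [R_lin R_even]; split=> [y a u v|x a u v|].
- by rewrite /star_of R_lin mu_linl opprD scalerN.
- by rewrite /star_of mu_linr opprD scalerN.
- by move=> i j x y Ax Ay; rewrite memvN mu_even ?R_even.
Qed.

(** The two minus signs cancel, [R] passes through [alpha], and Hom-associativity applies to [R x],
    [R y], [z], homogeneous because [R] is even. *)
Lemma star_of_star_of (K : fieldType) (A : superspace K)
    (mu : A -> A -> A) (alpha R : A -> A) (i j k : bool) (x y z : A) :
  is_supercomm_Hom_assoc mu alpha -> is_anti_Rota_Baxter mu alpha R ->
  x \in parity_part A i -> y \in parity_part A j -> z \in parity_part A k ->
  star_of mu R (alpha x) (star_of mu R y z) = mu (mu (R x) (R y)) (alpha z).
Proof.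
move=> hA [[_ R_even] R_alpha _] Ax Ay Az.
have [_ mu_linr _] := sca_mu_even_bilinear hA.
rewrite /star_of (linear_opp (mu_linr _)) opprK R_alpha.
by rewrite (sca_Hom_assoc hA (R_even _ _ Ax) (R_even _ _ Ay) Az).
Qed.

Theorem corollary3p1 (K : fieldType) (charK0 : [pchar K]%R =i pred0)
    (A : superspace K) (mu : A -> A -> A) (alpha R : A -> A)
    (hA : is_supercomm_Hom_assoc mu alpha)
    (hR : is_strong_anti_Rota_Baxter mu alpha R) :
  is_Hom_anti_Zinbiel (star_of mu R) alpha.
Proof.
have [hRB R_strong] := hR; have [[R_lin R_even] _ R_id] := hRB.
have [mu_bil [_ alpha_even] mu_comm _] := hA.
have [mu_linl _ mu_even] := mu_bil.
split.
- by apply: star_of_even_bilinear => //; case: hRB.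
- by case: hA.
- move=> i j k x y z Ax Ay Az; rewrite (star_of_star_of hA hRB Ax Ay Az).
  (* As [R y] has the parity of [y], the sign is exactly the one that turns [mu (R y) x] into
     [mu x (R y)]. *)
  rewrite /star_of opprK scalerN -opprD -(mu_comm _ _ _ _ Ax (R_even _ _ Ay)).
  by rewrite (linear_opp R_lin) (R_id _ _ _ _ Ax Ay).
- move=> i j k x y z Ax Ay Az.
  rewrite (star_of_star_of hA hRB Ax Ay Az) (star_of_star_of hA hRB Ay Az Ax).
  (* What remains is to swap [alpha x], of parity [i], with [mu (R y) (R z)], of parity [j (+) k]:
     this is the cyclic sign. *)
  rewrite R_strong; apply: mu_comm; first exact: alpha_even.
  by apply: mu_even; exact: R_even.
Qed.
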